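(* Let $\mathcal{T}=\{(x_i,y_i)\}_{i=1}^n$ be a training set with real targets $y_i$, and let $f_\theta$ be a real-valued function approximator, differentiable in its parameter vector $\theta$, such that $\sum_{i=1}^n |f_\theta(x_i)-y_i|\neq 0$. Let $q(\cdot,\cdot;\theta)$ be the error-based prioritized sampling distribution on $\mathcal{T}$, that is, $q(x_j,y_j;\theta)=\frac{|f_\theta(x_j)-y_j|}{\sum_{i=1}^n|f_\theta(x_i)-y_i|}$ for each $j\in\{1,\dots,n\}$. Then there is a constant $c$ determined by $\theta$ and $\mathcal{T}$ such that $$c\,\mathbb{E}_{(x,y)\sim q(x,y;\theta)}\left[\nabla_\theta\, \tfrac12 (f_\theta(x)-y)^2\right]=\mathbb{E}_{(x,y)\sim \mathrm{uniform}(\mathcal{T})}\left[\nabla_\theta\, \tfrac13 |f_\theta(x)-y|^3\right].$$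
   Context: $\mathrm{uniform}(\mathcal{T})$ is the distribution assigning probability $1/n$ to each of the $n$ training samples (indexed by $i=1,\dots,n$). The prioritized distribution $q(\cdot,\cdot;\theta)$ assigns to the $j$-th sample the probability $|f_\theta(x_j)-y_j|/\sum_{i=1}^n|f_\theta(x_i)-y_i|$. The gradients are taken inside the expectations, per sample, with respect to $\theta$; the dependence of $q$ on $\theta$ is not differentiated. *)

(* Defs.v *)
From mathcomp Require Import all_boot all_order all_algebra.
From mathcomp Require Import all_classical all_reals all_analysis.

Set Implicit Arguments.
Unset Strict Implicit.
Unset Printing Implicit Defensive.

Import Order.TTheory GRing.Theory Num.Theory.
Import numFieldNormedType.Exports.
Local Open Scope ring_scope.
Local Open Scope classical_set_scope.

(* Row vector of partial derivatives. Each entry is the library's total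
   directional derivative, hence a junk value where g is not derivable. *)
Definition gradient (R : realType) (d : nat) (g : 'rV[R]_d -> R)
    (theta : 'rV[R]_d) : 'rV[R]_d :=
  \row_(k < d) 'D_(delta_mx 0 k) g theta.

(* A training set is a family T : 'I_n -> X * R rather than a set of pairs, so
   repeated samples count with their multiplicity; a distribution on T is given
   by its probability mass function on the index set 'I_n. *)
Section Sampling.
Context {R : realType} {X : Type} {d n : nat}.
Implicit Types (T : 'I_n -> X * R) (p : 'I_n -> R).

Definition abs_error (f : 'rV[R]_d -> X -> R) (theta : 'rV[R]_d)
    (z : X * R) : R :=
  `|f theta z.1 - z.2|.

Definition is_pmf p : Prop :=
  (forall j, 0 <= p j) /\ \sum_(j < n) p j = 1.

Definition uniform_pmf : 'I_n -> R := fun=> n%:R^-1.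

Definition prioritized_pmf (f : 'rV[R]_d -> X -> R) (theta : 'rV[R]_d) T :
    'I_n -> R :=
  fun j => abs_error f theta (T j) / \sum_(i < n) abs_error f theta (T i).

Definition expectation_over T p (v : X * R -> 'rV[R]_d) : 'rV[R]_d :=
  \sum_(j < n) p j *: v (T j).

Lemma uniform_pmfP : (0 < n)%N -> is_pmf uniform_pmf.
Proof.
move=> n0; split=> [j|]; first by rewrite invr_ge0 ler0n.
by rewrite sumr_const card_ord -[LHS]mulr_natr mulVf// pnatr_eq0 -lt0n.
Qed.

Lemma prioritized_pmfP (f : 'rV[R]_d -> X -> R) (theta : 'rV[R]_d) T :
  \sum_(i < n) abs_error f theta (T i) != 0 ->
  is_pmf (prioritized_pmf f theta T).
Proof.
move=> s0; split=> [j|]; last by rewrite -mulr_suml divff.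
by rewrite divr_ge0 ?sumr_ge0// /abs_error.
Qed.

End Sampling.

(* Main.v *)
(* Each sample contributes |e| e grad f to the uniform expectation of the cubic
   loss and, with e the signed error and S the total absolute error,
   (|e| / S) e grad f to the prioritized expectation of the squared loss; the
   two expectations differ by the factor c = S / n. *)
Require Import Defs.
From mathcomp Require Import all_boot all_order all_algebra.
From mathcomp Require Import all_classical all_reals all_analysis.
From mathcomp Require Import ring.
Import Order.TTheory GRing.Theory Num.Theory.
Import numFieldNormedType.Exports.
Local Open Scope ring_scope.
Local Open Scope classical_set_scope.

(** The cube smooths out the kink of the norm at 0: the origin is handled by a continuous slope
    function, every other point by the local constancy of the sign. *)
Lemma is_derive_norm_exp3 (R : realType) (s : R) :
  is_derive s 1 (fun t : R => `|t| ^+ 3) (3 * `|s| * s).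
Proof.
have [->|s0] := eqVneq s 0.
  (* The slope from 0 to [z] is [z * |z|], because [|z| ^+ 3 = (z * |z|) * z]; its value at 0 is the
     derivative. *)
  apply/is_derive1_caratheodory; exists (fun z => z * `|z|); split.
  - move=> z; rewrite normr0 expr0n /= !subr0.
    have [z0|z0] := leP 0 z; rewrite ?(ger0_norm z0) ?(ltr0_norm z0);
      ring.
  - by apply: cvgM; [exact: cvg_id|exact: norm_continuous].
  - by rewrite normr0 !mulr0.
(* Near a nonzero [s] the sign is that of [s], so the function agrees there with a fixed multiple of
   the cube. *)
apply: (@near_eq_is_derive _ _ _ (Num.sg s \*: ((@id R : R -> R) ^+ 3))).
  have [s_gt0|s_lt0] := ltrP 0 s.
    near=> z; have z0 : 0 < z by near: z; exact: lt_nbhsr.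
    by rewrite /= gtr0_sg// [LHS]mul1r gtr0_norm.
  have {}s_lt0 : s < 0 by rewrite lt_neqAle s0.
  near=> z; have z0 : z < 0 by near: z; exact: lt_nbhsl.
  by rewrite /= ltr0_sg// [LHS]mulN1r ltr0_norm// [RHS]exprNn -signr_odd mulN1r.
apply: is_derive_eq.
rewrite normrEsg /= /GRing.scale /=; ring.
Unshelve. all: by end_near. Qed.

(** Chain rule for differentials; the outer one is a linear map on [R], hence multiplication by its
    value [dh] at 1. *)
Lemma derive_comp (R : realType) (V : normedModType R) (g : V -> R)
    (h : R -> R) (a v : V) (dh : R) :
  differentiable g a -> is_derive (g a) 1 h dh ->
  'D_v (fun t => h (g t)) a = dh * 'D_v g a.
Proof.
move=> dg [/derivable1_diffP dfh dhE].
rewrite (deriveE v (differentiable_comp dg dfh)) diff_comp//=.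
by rewrite diff1E// derive1E dhE deriveE// mulrC.
Qed.

Lemma gradient_comp (R : realType) (d : nat) (g : 'rV[R]_d -> R) (h : R -> R)
    (a : 'rV[R]_d) (dh : R) :
  differentiable g a -> is_derive (g a) 1 h dh ->
  gradient (fun t => h (g t)) a = dh *: gradient g a.
Proof.
by move=> dg dh_g; apply/rowP => k; rewrite !mxE; apply: derive_comp.
Qed.

Lemma gradient_half_sqr (R : realType) (d : nat) (g : 'rV[R]_d -> R)
    (a : 'rV[R]_d) : differentiable g a ->
  gradient (fun t => 2^-1 * g t ^+ 2) a = g a *: gradient g a.
Proof.
move=> dg; apply: (@gradient_comp _ _ g (fun s => 2^-1 * s ^+ 2)) => //.
apply: (@is_derive_eq _ _ _ (2^-1 \*: ((@id R : R -> R) ^+ 2))).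
by rewrite /GRing.scale /=; field.
Qed.

(** The norm is absorbed into an outer function derivable everywhere, so samples with zero error are
    covered too. *)
Lemma gradient_third_norm_exp3 (R : realType) (d : nat) (g : 'rV[R]_d -> R)
    (a : 'rV[R]_d) : differentiable g a ->
  gradient (fun t => 3^-1 * `|g t| ^+ 3) a = (`|g a| * g a) *: gradient g a.
Proof.
move=> dg; apply: (@gradient_comp _ _ g (fun s => 3^-1 * `|s| ^+ 3)) => //.
(* Placed in the context for instance resolution to use on the scaled function. *)
have dn := is_derive_norm_exp3 R (g a).
apply: (@is_derive_eq _ _ _ (3^-1 \*: (fun s : R => `|s| ^+ 3))).
by rewrite /GRing.scale /=; field.
Qed.

Theorem theorem1 (R : realType) (X : Type) (d n : nat)
    (f : 'rV[R]_d -> X -> R) :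
  exists c : 'rV[R]_d -> ('I_n -> X * R) -> R,
    forall (theta : 'rV[R]_d) (T : 'I_n -> X * R),
      (forall x : X, differentiable (fun t : 'rV[R]_d => f t x) theta) ->
      \sum_(i < n) `|f theta (T i).1 - (T i).2| != 0 ->
      c theta T *:
        expectation_over T (prioritized_pmf f theta T)
          (fun z : X * R =>
             gradient (fun t : 'rV[R]_d => 2^-1 * (f t z.1 - z.2) ^+ 2) theta)
      = expectation_over T uniform_pmf
          (fun z : X * R =>
             gradient (fun t : 'rV[R]_d => 3^-1 * `|f t z.1 - z.2| ^+ 3) theta).
Proof.
exists (fun theta T => (\sum_(i < n) abs_error f theta (T i)) / n%:R).
move=> theta T df S0; rewrite /expectation_over scaler_sumr.
(* The factor is the same for all samples, so the sums are compared term by term. *)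
apply: eq_bigr => j _.
have dg : differentiable (fun t => f t (T j).1 - (T j).2) theta.
  exact: differentiableB.
rewrite (gradient_half_sqr _ _ _ _ dg) (gradient_third_norm_exp3 _ _ _ _ dg).
rewrite !scalerA /prioritized_pmf /uniform_pmf; congr (_ *: _).
(* The index [j] itself witnesses that [n] is positive. *)
have n0 : n%:R != 0 :> R by rewrite pnatr_eq0 -lt0n (leq_trans _ (ltn_ord j)).
by rewrite /abs_error; field; rewrite n0.
Qed.
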